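(* Let $X$ be a set and let $\Phi$ be a mapping with the domain $X^2$. If $\Phi$ is combinatorially similar to a pseudometric, then there is a Ptolemaic pseudometric $d$ such that $\Phi$ is combinatorially similar to $d$.
   Context: A mapping $\Phi$ with domain $X^2$ may take values in an arbitrary set; $\Phi(X^2)$ is its image. A pseudometric on a set $Y$ is a function $d\colon Y^2\to\mathbb{R}$ that is nonnegative, symmetric, satisfies $d(x,x)=0$ for all $x\in Y$, and satisfies the triangle inequality. It is Ptolemaic if $d(x,z)d(y,t)+d(x,t)d(y,z)\geqslant d(x,y)d(z,t)$ for all $x,y,z,t\in Y$. A mapping $\Phi$ with domain $X^2$ is combinatorially similar to a mapping $\Psi$ with domain $Y^2$ if there are bijections $f\colon\Phi(X^2)\to\Psi(Y^2)$ and $g\colon Y\to X$ such that $\Psi(x,y)=f(\Phi(g(x),g(y)))$ for all $x,y\in Y$. *)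

(* Defs.v *)
From mathcomp Require Import all_boot all_order all_algebra.
From mathcomp Require Import all_classical reals.

Set Implicit Arguments.
Unset Strict Implicit.
Unset Printing Implicit Defensive.

Import Order.TTheory GRing.Theory Num.Theory.

Local Open Scope classical_set_scope.
Local Open Scope ring_scope.

Definition in_range (A V : Type) (F : A -> V) (a : A) : set_type (range F) :=
  SigSub (mem_range F a).

(* The bijection between the images acts on the subtypes carried by them rather
   than on the ambient types, so that nothing depends on the codomains V and W
   (which may, for instance, be empty when X and Y are). *)
Definition comb_similar (X V Y W : Type) (Phi : X * X -> V) (Psi : Y * Y -> W)
    : Prop :=
  exists (f : set_type (range Phi) -> set_type (range Psi)) (g : Y -> X),
    [/\ bijective f, bijective g &
        forall x y : Y, Psi (x, y) = \val (f (in_range Phi (g x, g y)))].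

Definition is_pseudometric (R : realType) (Y : Type) (d : Y * Y -> R) : Prop :=
  [/\ forall x y : Y, 0 <= d (x, y),
      forall x y : Y, d (x, y) = d (y, x),
      forall x : Y, d (x, x) = 0 &
      forall x y z : Y, d (x, z) <= d (x, y) + d (y, z)].

Definition is_ptolemaic (R : realType) (Y : Type) (d : Y * Y -> R) : Prop :=
  forall x y z t : Y,
    d (x, z) * d (y, t) + d (x, t) * d (y, z) >= d (x, y) * d (z, t).

(* Main.v *)
Require Import Defs.
From mathcomp Require Import all_boot all_order all_algebra.
From mathcomp Require Import all_classical reals.
From mathcomp Require Import lra.

(** Compose the given pseudometric with an injection of [0, +oo[ into
    {0} `|` [1, 4/3] fixing 0.  Points at distance 0 are interchangeable, so both
    the triangle and the Ptolemy inequality reduce to an equality when a term on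
    their right-hand side vanishes; otherwise they follow from 4/3 <= 1 + 1 and
    (4/3)^2 <= 1 + 1. *)

Set Implicit Arguments.
Unset Strict Implicit.
Unset Printing Implicit Defensive.

Import Order.TTheory GRing.Theory Num.Theory.

Local Open Scope classical_set_scope.
Local Open Scope ring_scope.

(** Since [h] is injective on the image of [Psi], it induces a bijection between the images of [Psi]
    and [h \o Psi]; composing it with [f] and keeping [g] gives the similarity. *)
Lemma comb_similar_comp (X V Y W U : Type) (Phi : X * X -> V)
    (Psi : Y * Y -> W) (h : W -> U) :
  {in range Psi &, injective h} ->
  comb_similar Phi Psi -> comb_similar Phi (h \o Psi).
Proof.
move=> h_inj [f [g [f_bij g_bij fg]]].
have pre (v : set_type (range (h \o Psi))) : {p | h (Psi p) = \val v}.
  by have /cid2[p _ pv] := set_mem (valP v); exists p.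
have img (v : set_type (range Psi)) : h (\val v) \in range (h \o Psi).
  by have [p _ <-] := set_mem (valP v); apply: mem_set; exists p.
pose u (v : set_type (range Psi)) : set_type (range (h \o Psi)) :=
  SigSub (img v).
have u_bij : bijective u.
  (* The inverse evaluates [Psi] at a chosen point of the fibre over [v]; injectivity of [h] makes
     this value independent of the choice. *)
  exists (fun v => in_range Psi (sval (pre v))) => v; apply: val_inj => /=.
    apply: h_inj; [exact: (valP (in_range Psi _)) | exact: (valP v) |].
    exact: (svalP (pre (u v))).
  exact: (svalP (pre v)).
exists (u \o f), g; split => //; first exact: bij_comp.
by move=> x y /=; rewrite fg.
Qed.

Section Rescaling.
Variable R : realType.
Implicit Types t s : R.

(** On positive [t] the formula increases strictly, with limits 1 at 0 and 4/3 at infinity, so there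
    is a jump at 0. *)
Definition rescale t : R := if t == 0 then 0 else 4 / 3 - (3 * (1 + t))^-1.

Lemma rescale0 : rescale 0 = 0.
Proof. by rewrite /rescale eqxx. Qed.

Lemma rescale_bounds t : 0 <= t -> t != 0 -> 1 <= rescale t <= 4 / 3.
Proof.
move=> t0 /negbTE tn0; rewrite /rescale tn0.
have pos : 0 < (3 * (1 + t))^-1 by rewrite invr_gt0; lra.
have : (3 * (1 + t))^-1 <= 3^-1 by rewrite lef_pV2 ?posrE; lra.
lra.
Qed.

Lemma rescale_eq0 t : 0 <= t -> (rescale t == 0) = (t == 0).
Proof.
move=> t0; have [->|tn0] := eqVneq t 0; first by rewrite rescale0 eqxx.
by have := rescale_bounds t0 tn0; case: eqP => // ->; lra.
Qed.

Lemma rescale_inj t s : 0 <= t -> 0 <= s -> rescale t = rescale s -> t = s.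
Proof.
move=> t0 s0 ts; have := rescale_eq0 t0; rewrite ts rescale_eq0 //.
have [->|sn0] := eqVneq s 0 => /esym; first by move/eqP.
move=> tn0; move: ts; rewrite /rescale tn0 (negbTE sn0).
by move/addrI/oppr_inj/invr_inj; lra.
Qed.

Variables (Y : Type) (rho : Y * Y -> R).
Hypothesis rho_pm : is_pseudometric rho.

Let d := rescale \o rho.

Lemma rescale_pseudometric_sym x y : d (x, y) = d (y, x).
Proof. by case: rho_pm => _ C _ _; rewrite /d /= C. Qed.

(** If [rho (x, y)] vanishes, the triangle inequality applied through [x] and through [y] shows that
    both points have the same [rho]-distance to any [z]. *)
Lemma rescale_pseudometric_cases x y :
  (forall z, d (x, z) = d (y, z)) \/ 1 <= d (x, y) <= 4 / 3.
Proof.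
case: rho_pm => P C _ T.
have [xy|xy] := eqVneq (rho (x, y)) 0; [left => z | right].
  rewrite /d /=; congr (rescale _); apply/eqP.
  have := T x y z; have := T y x z; rewrite (C y x); lra.
exact: rescale_bounds.
Qed.

Lemma rescale_pseudometric_bounds x y : 0 <= d (x, y) <= 4 / 3.
Proof.
case: rho_pm => P _ _ _; rewrite /d /=.
have [->|xy] := eqVneq (rho (x, y)) 0; first by rewrite rescale0; lra.
by have := rescale_bounds (P x y) xy; lra.
Qed.

Lemma rescale_pseudometric : is_pseudometric d.
Proof.
have [_ _ Z _] := rho_pm; split.
- by move=> x y; case/andP: (rescale_pseudometric_bounds x y).
- exact: rescale_pseudometric_sym.
- by move=> x; rewrite /d /= Z rescale0.
move=> x y z.
have /andP[? ?] := rescale_pseudometric_bounds x y.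
have /andP[? ?] := rescale_pseudometric_bounds y z.
have /andP[? ?] := rescale_pseudometric_bounds x z.
have [->|?] := rescale_pseudometric_cases x y; first lra.
have [yz|?] := rescale_pseudometric_cases y z; last lra.
(* Symmetry moves [y] to the first argument, where it can be exchanged for [z]. *)
by rewrite ![d (x, _)]rescale_pseudometric_sym yz; lra.
Qed.

(** The four pairs on the larger side are tested in turn. If one is interchangeable, the product on
    the smaller side equals the product not containing that pair, and the other product is
    nonnegative. *)
Lemma rescale_ptolemaic : is_ptolemaic d.
Proof.
have C := rescale_pseudometric_sym.
have B := rescale_pseudometric_bounds.
move=> x y z t.
have [xz|xz] := rescale_pseudometric_cases x z.
  rewrite (xz y) (xz t) (C z y) mulrC lerDr.
  by rewrite mulr_ge0 //; [case/andP: (B x z) | case/andP: (B y t)].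
have [yt|yt] := rescale_pseudometric_cases y t.
  rewrite (C x y) (yt x) (C t x) (C z t) -(yt z) lerDr.
  by rewrite mulr_ge0 //; [case/andP: (B x z) | case/andP: (B y t)].
have [xt|xt] := rescale_pseudometric_cases x t.
  rewrite (xt y) (C t y) (C z t) -(xt z) mulrC lerDl.
  by rewrite mulr_ge0 //; [case/andP: (B x t) | case/andP: (B y z)].
have [yz|yz] := rescale_pseudometric_cases y z.
  rewrite (C x y) (yz x) (C z x) -(yz t) lerDl.
  by rewrite mulr_ge0 //; [case/andP: (B x t) | case/andP: (B y z)].
(* Both products on the larger side are now at least 1. The pairs [x, y] and [z, t] may still be at
   distance 0, but only their upper bound 4/3 matters. *)
have far (p q r s : Y) : 1 <= d (p, q) <= 4 / 3 -> 1 <= d (r, s) <= 4 / 3 ->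
    1 <= d (p, q) * d (r, s).
  by move=> /andP[pq _] /andP[rs _]; rewrite -[1]mulr1 ler_pM.
have := far _ _ _ _ xz yt; have := far _ _ _ _ xt yz.
have : d (x, y) * d (z, t) <= 4 / 3 * (4 / 3).
  by have /andP[? ?] := B x y; have /andP[? ?] := B z t; rewrite ler_pM.
lra.
Qed.

End Rescaling.

Theorem corollary3p2 (R : realType) (X V : Type) (Phi : X * X -> V) :
  (exists (Y : Type) (rho : Y * Y -> R),
      is_pseudometric rho /\ comb_similar Phi rho) ->
  exists (Y : Type) (d : Y * Y -> R),
    [/\ is_pseudometric d, is_ptolemaic d & comb_similar Phi d].
Proof.
move=> [Y [rho [rho_pm sim]]]; exists Y, (@rescale R \o rho); split.
- exact: rescale_pseudometric.
- exact: rescale_ptolemaic.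
(* Injectivity of [rescale] holds on nonnegative reals, which contain all values of [rho]. *)
apply: comb_similar_comp sim => t s /set_mem[[x y] _ <-] /set_mem[[z w] _ <-].
by case: rho_pm => P _ _ _; exact: rescale_inj.
Qed.
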